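(* Let $X$ be a linear $n$-normed space over $\mathbb{R}$, let $b_2,\dots,b_n\in X$ be fixed elements, and let $W$ be a subspace of $X$. Let $x_0\in X$ be such that $x_0,b_2,\dots,b_n$ are linearly independent, and suppose $d=\inf_{x\in W}\|x_0-x,b_2,\dots,b_n\|>0$. Then there exists $T\in X_F^{*}$ such that (I) $T(x_0,b_2,\dots,b_n)=1$, and (II) $T(x,b_2,\dots,b_n)=0$ for all $x\in W$ and $\|T\|=\frac1d$.
   Context: Let $n$ be a positive integer and let $X$ be a linear space over $\mathbb{K}$ ($=\mathbb{R}$ or $\mathbb{C}$) with $\dim X\ge n$. An $n$-norm on $X$ is a function $\|\cdot,\dots,\cdot\|:X^n\to\mathbb{R}$ such that: (N1) $\|x_1,\dots,x_n\|=0$ if and only if $x_1,\dots,x_n$ are linearly dependent; (N2) $\|x_1,\dots,x_n\|$ is invariant under permutations of $x_1,\dots,x_n$; (N3) $\|\alpha x_1,x_2,\dots,x_n\|=|\alpha|\,\|x_1,x_2,\dots,x_n\|$ for all $\alpha\in\mathbb{K}$; (N4) $\|x+y,x_2,\dots,x_n\|\le\|x,x_2,\dots,x_n\|+\|y,x_2,\dots,x_n\|$. The pair $(X,\|\cdot,\dots,\cdot\|)$ is a linear $n$-normed space. Fix $b_2,\dots,b_n\in X$ and let $\langle b_i\rangle$ be the subspace generated by $b_i$. For a subspace $W$ of $X$, a $b$-linear functional on $W\times\langle b_2\rangle\times\cdots\times\langle b_n\rangle$ is a map $T:W\times\langle b_2\rangle\times\cdots\times\langle b_n\rangle\to\mathbb{K}$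 with $T(x+y,b_2,\dots,b_n)=T(x,b_2,\dots,b_n)+T(y,b_2,\dots,b_n)$ and $T(kx,b_2,\dots,b_n)=k\,T(x,b_2,\dots,b_n)$ for all $x,y\in W$, $k\in\mathbb{K}$. It is bounded if there is $M>0$ with $|T(x,b_2,\dots,b_n)|\le M\|x,b_2,\dots,b_n\|$ for all $x\in W$; its norm $\|T\|$ is the infimum of all such $M$. $X_F^{*}$ denotes the set of all bounded $b$-linear functionals on $X\times\langle b_2\rangle\times\cdots\times\langle b_n\rangle$. Here $\mathbb{K}=\mathbb{R}$. *)

(* Defs.v *)
From HB Require Import structures.
From mathcomp Require Import all_boot all_order all_algebra all_fingroup.
From mathcomp Require Import boolp classical_sets reals.
Set Implicit Arguments.
Unset Strict Implicit.
Unset Printing Implicit Defensive.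
Import Order.TTheory GRing.Theory Num.Theory.
Local Open Scope classical_set_scope.
Local Open Scope ring_scope.

(* The number of arguments of an n-norm is positive and is written n.+1
   throughout; the fixed family b_2, ..., b_{n+1} is b : n.-tuple X. *)

Definition lin_dep (R : realType) (X : lmodType R) (n : nat)
    (x : n.-tuple X) : Prop :=
  exists2 a : 'I_n -> R,
    (exists i, a i != 0) & \sum_(i < n) a i *: tnth x i = 0.

Definition lin_indep (R : realType) (X : lmodType R) (n : nat)
    (x : n.-tuple X) : Prop := ~ lin_dep x.

(* X need not be finite-dimensional. *)
Definition dim_ge (R : realType) (X : lmodType R) (n : nat) : Prop :=
  exists x : n.-tuple X, lin_indep x.

Record n_norm (R : realType) (X : lmodType R) (n : nat)
    (N : n.+1.-tuple X -> R) : Prop := NNorm {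
  n_norm_eq0 : forall x : n.+1.-tuple X, N x = 0 <-> lin_dep x;
  n_norm_perm : forall (s : 'S_n.+1) (x : n.+1.-tuple X),
    N [tuple tnth x (s i) | i < n.+1] = N x;
  n_normZ : forall (a : R) (x : X) (y : n.-tuple X),
    N [tuple of a *: x :: y] = `|a| * N [tuple of x :: y];
  n_normD : forall (x x' : X) (y : n.-tuple X),
    N [tuple of (x + x') :: y] <= N [tuple of x :: y] + N [tuple of x' :: y]
}.

Record linear_n_normed_space (R : realType) (X : lmodType R) (n : nat)
    (N : n.+1.-tuple X -> R) : Prop := LinearNNormedSpace {
  n_normed_dim : dim_ge X n.+1;
  n_normed_norm : n_norm N
}.

Definition line (R : realType) (X : lmodType R) (b : X) : {pred X} :=
  [pred x | `[< exists k : R, x = k *: b >]].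

(* The domain W x <b_2> x ... x <b_{n+1}>, as a type. *)
Definition bdom (R : realType) (X : lmodType R) (n : nat)
    (W : {pred X}) (b : n.-tuple X) : Type :=
  {v : n.+1.-tuple X | (thead v \in W) &&
     [forall i : 'I_n, tnth v (lift ord0 i) \in line (tnth b i)]}.

Lemma bpoint_subproof (R : realType) (X : lmodType R) (n : nat)
    (W : {pred X}) (b : n.-tuple X) (x : X) (Wx : x \in W) :
  (thead [tuple of x :: b] \in W) &&
  [forall i : 'I_n,
     tnth [tuple of x :: b] (lift ord0 i) \in line (tnth b i)].
Proof.
rewrite theadE Wx /=; apply/forallP => i; rewrite tnthS.
by apply/asboolP; exists 1; rewrite scale1r.
Qed.

(* The point (x, b_2, ..., b_{n+1}) of that domain. *)
Definition bpoint (R : realType) (X : lmodType R) (n : nat)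
    (W : {pred X}) (b : n.-tuple X) (x : X) (Wx : x \in W) : bdom W b :=
  exist _ [tuple of x :: b] (bpoint_subproof b Wx).

(* A b-linear functional is only constrained at the points
   (x, b_2, ..., b_{n+1}); its values elsewhere on the domain are free. *)
Record b_linear (R : realType) (X : lmodType R) (n : nat)
    (W : {pred X}) (b : n.-tuple X) (T : bdom W b -> R) : Prop := BLinear {
  b_linearD : forall (x y : X) (Wx : x \in W) (Wy : y \in W)
      (Wxy : x + y \in W),
    T (bpoint b Wxy) = T (bpoint b Wx) + T (bpoint b Wy);
  b_linearZ : forall (k : R) (x : X) (Wx : x \in W) (Wkx : k *: x \in W),
    T (bpoint b Wkx) = k * T (bpoint b Wx)
}.

Definition b_bounds (R : realType) (X : lmodType R) (n : nat)
    (N : n.+1.-tuple X -> R) (W : {pred X}) (b : n.-tuple X)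
    (T : bdom W b -> R) : set R :=
  [set M | 0 < M /\ forall (x : X) (Wx : x \in W),
     `|T (bpoint b Wx)| <= M * N [tuple of x :: b]].

Definition b_bounded (R : realType) (X : lmodType R) (n : nat)
    (N : n.+1.-tuple X -> R) (W : {pred X}) (b : n.-tuple X)
    (T : bdom W b -> R) : Prop := exists M : R, b_bounds N T M.

Definition b_opnorm (R : realType) (X : lmodType R) (n : nat)
    (N : n.+1.-tuple X -> R) (W : {pred X}) (b : n.-tuple X)
    (T : bdom W b -> R) : R := inf (b_bounds N T).

(* The set X_F^* of bounded b-linear functionals on the whole space. *)
Definition b_dual (R : realType) (X : lmodType R) (n : nat)
    (N : n.+1.-tuple X -> R) (b : n.-tuple X) :
    set (bdom (predT : {pred X}) b -> R) :=
  [set T | b_linear T /\ b_bounded N T].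

Definition bpointT (R : realType) (X : lmodType R) (n : nat)
    (b : n.-tuple X) (x : X) : bdom (predT : {pred X}) b :=
  bpoint b (isT : x \in (predT : {pred X})).

(* Main.v *)
Require Import Defs.
From HB Require Import structures.
From mathcomp Require Import all_boot all_order all_algebra all_fingroup.
From mathcomp Require Import boolp classical_sets reals.
From mathcomp Require Import lra.
Set Implicit Arguments.
Unset Strict Implicit.
Unset Printing Implicit Defensive.
Import Order.TTheory GRing.Theory Num.Theory.
Local Open Scope classical_set_scope.
Local Open Scope ring_scope.

(** Fixing the last arguments of the n-norm at b turns it into a seminorm
    p x = N (x, b) on X, and b-linear functionals on the whole space are just
    linear forms on X.  The statement is then the classical corollary of
    Hahn-Banach: a linear form f <= p that vanishes on W and takes at x0 the
    value d, the p-distance from x0 to W; the functional is T = f / d.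

    The Hahn-Banach part is done without extending partially defined forms.
    A minimal sublinear functional is linear (sublinear_minimal_scalar), and
    Zorn's lemma puts a minimal one below every sublinear functional
    (sublinear_dominates_scalar).  Constraints on f are built in beforehand by
    lowering p: for a convex cone K of pairs (v, s) with 0 <= p v + s, the
    infimum over K of p (x + v) + s is still sublinear, and every linear form
    below it satisfies 0 <= f v + s on K (cone_dominated_scalar).  With K the
    cone of the pairs (w + t x0, - t d) for w in W and 0 <= t, this says
    f = 0 on W and d <= f x0; the reverse inequality is
    f x0 = f (x0 - w) <= p (x0 - w).

    For the norm, |f| <= p makes 1 / d a bound for T.  Conversely a bound M
    gives 1 = |T (x0 - w)| <= M p (x0 - w) for all w in W, so 1 / M <= d. *)

(** * Sublinear functionals *)

Section Sublinear.
Variables (R : realType) (X : lmodType R).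
Implicit Types (p q : X -> R) (x y : X).

(** Homogeneity is only asked as an inequality, which is what passes to
    infima; equality follows by scaling back (see sublinearZ). *)
Definition sublinear p :=
  (forall x y, p (x + y) <= p x + p y) /\
  (forall t x, 0 <= t -> p (t *: x) <= t * p x).

Lemma sublinear0 p : sublinear p -> p 0 = 0.
Proof.
move=> [pD pZ]; have := pD 0 0; have := pZ 0 0 (lexx _).
rewrite scale0r addr0; lra.
Qed.

Lemma sublinearN p x : sublinear p -> - p (- x) <= p x.
Proof.
move=> pS; have := pS.1 x (- x); rewrite subrr sublinear0 //; lra.
Qed.

Lemma sublinearZ p t x : sublinear p -> 0 <= t -> p (t *: x) = t * p x.
Proof.
move=> pS; rewrite le_eqVlt => /predU1P[<-|t_gt0].
  by rewrite scale0r mul0r sublinear0.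
have t_ge0 := ltW t_gt0.
apply/eqP; rewrite eq_le pS.2 //= -ler_pdivlMl //.
rewrite -{1}[x](scalerK (lt0r_neq0 t_gt0)).
by rewrite pS.2 // invr_ge0.
Qed.

Lemma le_inf_add (A B : set R) (c : R) : A !=set0 -> B !=set0 ->
  (forall a b, A a -> B b -> c <= a + b) -> c <= inf A + inf B.
Proof.
move=> A0 B0 cAB; rewrite -lerBlDl; apply: lb_le_inf => // b Bb.
rewrite lerBlDl -lerBlDr; apply: lb_le_inf => // a Aa.
by rewrite lerBlDr cAB.
Qed.

(** The members of the family need not be sublinear: it is enough that a bound
    coming from some members is improved by another one.  This covers
    both chains of sublinear functionals and translates of a single one. *)
Lemma sublinear_inf (F : set (X -> R)) (m : X -> R) : F !=set0 ->
    (forall g x, F g -> m x <= g x) ->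
    (forall g h x y, F g -> F h -> exists2 k, F k & k (x + y) <= g x + h y) ->
    (forall g t x, F g -> 0 <= t -> exists2 k, F k & k (t *: x) <= t * g x) ->
  exists2 q, sublinear q & forall g x, F g -> q x <= g x.
Proof.
move=> [g0 Fg0] Fm FD FZ; pose q x := inf [set g x | g in F].
have q_le g x : F g -> q x <= g x.
  move=> Fg; apply: ge_inf; last by exists g.
  by exists (m x) => _ [h Fh <-]; exact: Fm.
have F0 x : [set g x | g in F] !=set0 by exists (g0 x), g0.
exists q => //; split=> [x y|t x t_ge0].
  apply: le_inf_add => // _ _ [g Fg <-] [h Fh <-].
  by have [k Fk] := FD _ _ x y Fg Fh; apply: le_trans; exact: q_le.
move: (t_ge0); rewrite le_eqVlt => /predU1P[t0|t_gt0]; last first.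
  rewrite -ler_pdivrMl //; apply: lb_le_inf => // _ [g Fg <-].
  rewrite ler_pdivrMl //.
  by have [k Fk] := FZ _ _ x Fg t_ge0; apply: le_trans; exact: q_le.
have [k Fk] := FZ _ _ x Fg0 t_ge0; rewrite -t0 !mul0r.
by apply: le_trans; exact: q_le.
Qed.

(** The infimum of the functionals x |-> p (x + v) + s over the cone K; it is
    bounded below since p (x + v) + s >= p v - p (- x) + s >= - p (- x). *)
Lemma sublinear_cone_inf p (K : X -> R -> Prop) : sublinear p ->
    K 0 0 ->
    (forall v s v' s', K v s -> K v' s' -> K (v + v') (s + s')) ->
    (forall t v s, 0 <= t -> K v s -> K (t *: v) (t * s)) ->
    (forall v s, K v s -> 0 <= p v + s) ->
  exists2 q, sublinear q & forall v s x, K v s -> q x <= p (x + v) + s.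
Proof.
move=> pS K0 KD KZ Kp.
pose F := [set g | exists v s, K v s /\ g = fun x => p (x + v) + s].
have [||||q qS qF] := @sublinear_inf F (fun x => - p (- x)).
- by exists (fun x => p (x + 0) + 0), 0, 0.
- move=> _ x [v [s [Kvs ->]]].
  have := pS.1 (- x) (x + v); rewrite addKr; have := Kp _ _ Kvs; lra.
- move=> _ _ x y [v [s [Kvs ->]]] [v' [s' [Kvs' ->]]].
  exists (fun z => p (z + (v + v')) + (s + s')).
    by exists (v + v'), (s + s'); split=> //; exact: KD.
  have := pS.1 (x + v) (y + v'); rewrite addrACA; lra.
- move=> _ t x [v [s [Kvs ->]]] t_ge0.
  exists (fun z => p (z + t *: v) + t * s).
    by exists (t *: v), (t * s); split=> //; exact: KZ.
  by rewrite -scalerDr mulrDr lerD2r pS.2.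
exists q => // v s x Kvs; apply: (qF (fun z => p (z + v) + s)).
by exists v, s.
Qed.

(** * Linear forms below a sublinear functional *)

(** For a fixed y, lowering q along the ray of y gives a sublinear functional
    at most q and with value at most q (x + y) - q y at x.  Minimality
    turns this into superadditivity of q. *)
Lemma sublinear_minimal_scalar q : sublinear q ->
    (forall g, sublinear g -> (forall x, g x <= q x) ->
       forall x, q x <= g x) ->
  scalar q.
Proof.
move=> qS qmin.
have qD x y : q (x + y) = q x + q y.
  apply/eqP; rewrite eq_le qS.1 /=.
  pose K v s := exists2 t : R, 0 <= t & v = t *: y /\ s = - (t * q y).
  have [||||g gS gK] := @sublinear_cone_inf q K qS.
  - by exists 0 => //; rewrite scale0r mul0r oppr0.
  - move=> _ _ _ _ [t t_ge0 [-> ->]] [u u_ge0 [-> ->]].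
    by exists (t + u); rewrite ?addr_ge0 // scalerDl mulrDl opprD.
  - move=> u _ _ u_ge0 [t t_ge0 [-> ->]].
    by exists (u * t); rewrite ?mulr_ge0 // scalerA mulrN mulrA.
  - by move=> _ _ [t t_ge0 [-> ->]]; rewrite sublinearZ // subrr.
  have g_le z : g z <= q z.
    rewrite -[q z]addr0 -{2}[z]addr0; apply: gK.
    by exists 0 => //; rewrite scale0r mul0r oppr0.
  rewrite -lerBrDr; apply: le_trans (qmin _ gS g_le x) _; apply: gK.
  by exists 1; rewrite // scale1r mul1r.
have qN x : q (- x) = - q x.
  by apply/eqP; rewrite -addr_eq0 -qD addNr sublinear0.
move=> t x y; rewrite qD; congr (_ + _).
have [t_ge0|/ltW t_le0] := leP 0 t; first exact: sublinearZ.
by rewrite -{1}[t]opprK scaleNr qN sublinearZ ?oppr_ge0 // -mulNr opprK.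
Qed.

(** Zorn's lemma for the reversed pointwise order: a chain below p has a
    sublinear pointwise infimum, because every sublinear r <= p satisfies
    - p (- x) <= - r (- x) <= r x. *)
Lemma sublinear_dominates_scalar p : sublinear p ->
  exists f : {scalar X}, forall x, f x <= p x.
Proof.
move=> pS; pose below := {q | sublinear q /\ forall x, q x <= p x}.
pose le_below (q r : below) := `[< forall x, sval r x <= sval q x >].
have p_below : sublinear p /\ forall x, p x <= p x by [].
have [|||[q [qS q_le]] qmin] :=
  @ZL_preorder below (exist _ p p_below) le_below.
- by move=> q; apply/asboolP.
- move=> r q s /asboolP qr /asboolP sq; apply/asboolP => x.
  exact: le_trans (sq x) (qr x).
- move=> A Atot.
  have [[a0 Aa0]|A0] := pselect (A !=set0); last first.
    by exists (exist _ p p_below) => s As; case: A0; exists s.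
  have [||||q qS qA] :=
    @sublinear_inf [set sval a | a in A] (fun x => - p (- x)).
  + by exists (sval a0), a0.
  + move=> _ x [[r [rS r_le]] _ <-] /=.
    by apply: le_trans (sublinearN x rS); rewrite lerN2.
  + move=> _ _ x y [a Aa <-] [b Ab <-].
    (* of two members of a chain, the smaller one does for both *)
    have [/asboolP ba|/asboolP ab] := Atot _ _ Aa Ab.
      exists (sval b); first by exists b.
      by apply: le_trans ((svalP b).1.1 x y) _; rewrite lerD2r.
    exists (sval a); first by exists a.
    by apply: le_trans ((svalP a).1.1 x y) _; rewrite lerD2l.
  + move=> _ t x [a Aa <-] t_ge0; exists (sval a); first by exists a.
    exact: (svalP a).1.2.
  have q_below : sublinear q /\ forall x, q x <= p x.
    split=> // x; apply: le_trans ((svalP a0).2 x).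
    by apply: qA; exists a0.
  exists (exist _ q q_below) => s As; apply/asboolP => x /=.
  by apply: qA; exists s.
have q_scalar : scalar q.
  apply: sublinear_minimal_scalar => // g gS g_le.
  have g_below : sublinear g /\ forall x, g x <= p x.
    by split=> // x; exact: le_trans (q_le x).
  have := qmin (exist _ g g_below) _.
  by move=> qg; apply/asboolP/qg/asboolP.
pose f : {scalar X} := HB.pack q (GRing.isLinear.Build R X R *%R q q_scalar).
by exists f.
Qed.

(** Evaluating the infimum of sublinear_cone_inf at - v gives
    f (- v) <= p 0 + s = s. *)
Lemma cone_dominated_scalar p (K : X -> R -> Prop) : sublinear p ->
    K 0 0 ->
    (forall v s v' s', K v s -> K v' s' -> K (v + v') (s + s')) ->
    (forall t v s, 0 <= t -> K v s -> K (t *: v) (t * s)) ->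
    (forall v s, K v s -> 0 <= p v + s) ->
  exists2 f : {scalar X}, (forall x, f x <= p x) &
    forall v s, K v s -> 0 <= f v + s.
Proof.
move=> pS K0 KD KZ Kp.
have [q qS qK] := sublinear_cone_inf pS K0 KD KZ Kp.
have [f f_le] := sublinear_dominates_scalar qS.
exists f => [x|v s Kvs].
  by apply: le_trans (f_le x) _; have := qK _ _ x K0; rewrite !addr0.
have := le_trans (f_le (- v)) (qK _ _ (- v) Kvs).
by rewrite addNr sublinear0 // add0r raddfN lerNl -subr_ge0 opprK.
Qed.

(** The Hahn-Banach separation of a point from a subspace, for a seminorm. *)
Lemma scalar_vanishing_at_distance p (W : {pred X}) (x0 : X) :
    sublinear p -> (forall x, p (- x) = p x) -> submod_closed W ->
    let d := inf [set p (x0 - x) | x in [set` W]] in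
  exists f : {scalar X}, [/\ forall x, `|f x| <= p x,
    forall x, x \in W -> f x = 0 & f x0 = d].
Proof.
move=> pS pN [W0 WZD] d.
have WD x y : x \in W -> y \in W -> x + y \in W.
  by move=> Wx Wy; rewrite -[x]scale1r WZD.
have WZ t x : x \in W -> t *: x \in W.
  by move=> Wx; rewrite -[_ *: _]addr0 WZD.
have WN x : x \in W -> - x \in W by move=> Wx; rewrite -scaleN1r WZ.
have p_ge0 x : 0 <= p x by have := sublinearN x pS; rewrite pN; lra.
have d_le w : w \in W -> d <= p (x0 - w).
  move=> Ww; apply: ge_inf; last by exists w.
  by exists 0 => _ [y _ <-].
pose K v s := exists w t, [/\ w \in W, 0 <= t, v = w + t *: x0 & s = - (t * d)].
have [||||f f_le fK] := @cone_dominated_scalar p K pS.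
- by exists 0, 0; split; rewrite // ?scale0r ?mul0r ?addr0 ?oppr0.
- move=> _ _ _ _ [w [t [Ww t_ge0 -> ->]]] [w' [t' [Ww' t_ge0' -> ->]]].
  exists (w + w'), (t + t'); split; rewrite ?WD ?addr_ge0 //.
    by rewrite scalerDl addrACA.
  by rewrite mulrDl opprD.
- move=> u _ _ u_ge0 [w [t [Ww t_ge0 -> ->]]].
  exists (u *: w), (u * t); split; rewrite ?WZ ?mulr_ge0 //.
    by rewrite scalerDr scalerA.
  by rewrite mulrN mulrA.
- move=> _ _ [w [t [Ww + -> ->]]].
  rewrite le_eqVlt => /predU1P[<-|t_gt0].
    by rewrite mul0r subr0.
  have t_ge0 := ltW t_gt0.
  have -> : w + t *: x0 = t *: (x0 - (- t^-1 *: w)).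
    rewrite scalerDr scaleNr opprK scalerA divff ?lt0r_neq0 //.
    by rewrite scale1r addrC.
  by rewrite sublinearZ // -mulrBr mulr_ge0 // subr_ge0 d_le // WZ.
have f_ge0 w : w \in W -> 0 <= f w.
  move=> Ww; rewrite -[f w]addr0; apply: fK.
  by exists w, 0; split; rewrite // ?scale0r ?mul0r ?addr0 ?oppr0.
have fW w : w \in W -> f w = 0.
  move=> Ww; have := f_ge0 _ (WN _ Ww); have := f_ge0 _ Ww.
  by rewrite raddfN; lra.
exists f; split=> // [x|].
  by rewrite ler_norml f_le andbT lerNl -raddfN -(pN x) f_le.
apply/eqP; rewrite eq_le; apply/andP; split.
  apply: lb_le_inf => [|_ [w Ww <-]]; first by exists (p (x0 - 0)), 0.
  by have := f_le (x0 - w); rewrite raddfB /= (fW w) // subr0.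
rewrite -subr_ge0; apply: fK.
by exists 0, 1; split; rewrite // ?scale1r ?mul1r ?add0r.
Qed.

End Sublinear.

(** * The seminorm of an n-norm with fixed last arguments *)

Section NNormSeminorm.
Variables (R : realType) (X : lmodType R) (n : nat).
Variables (N : n.+1.-tuple X -> R) (hN : n_norm N) (b : n.-tuple X).

Lemma n_norm_sublinear : sublinear (fun x => N [tuple of x :: b]).
Proof.
split=> [x y|t x t_ge0]; first exact: n_normD.
by rewrite n_normZ // ger0_norm.
Qed.

Lemma n_normN x : N [tuple of - x :: b] = N [tuple of x :: b].
Proof. by rewrite -scaleN1r n_normZ // normrN1 mul1r. Qed.

End NNormSeminorm.

(** * Bounded functionals separating a point from a subspace *)

Theorem theorem3p4 (R : realType) (X : lmodType R) (n : nat)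
    (N : n.+1.-tuple X -> R) (hN : linear_n_normed_space N)
    (b : n.-tuple X) (W : {pred X}) (hW : submod_closed W)
    (x0 : X) (hx0 : lin_indep [tuple of x0 :: b])
    (d : R)
    (hd : d = inf [set N [tuple of (x0 - x) :: b] | x in [set` W]])
    (d_gt0 : 0 < d) :
  exists T : bdom (predT : {pred X}) b -> R,
    [/\ b_dual N T,
        T (bpointT b x0) = 1,
        (forall x : X, x \in W -> T (bpointT b x) = 0)
      & b_opnorm N T = 1 / d].
Proof.
have nN := n_normed_norm hN.
have [f [f_le fW fx0]] := scalar_vanishing_at_distance x0
  (n_norm_sublinear nN b) (n_normN nN b) hW.
rewrite -hd in fx0.
pose T (v : bdom (predT : {pred X}) b) := f (thead (sval v)) / d.
have TE x (Px : x \in predT) : T (bpoint b Px) = f x / d by rewrite /T theadE.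
have T_bound : b_bounds N T (1 / d).
  split=> [|x Px]; first by rewrite divr_gt0.
  rewrite TE normrM normfV (gtr0_norm d_gt0) mulrC mul1r.
  by rewrite ler_wpM2l // invr_ge0 ltW.
exists T; split.
- split; last by exists (1 / d).
  split=> [x y Px Py Pxy|k x Px Pkx]; rewrite !TE.
    by rewrite raddfD mulrDl.
  by rewrite linearZ mulrA.
- by rewrite TE fx0 divff ?lt0r_neq0.
- by move=> x Wx; rewrite TE fW // mul0r.
apply/eqP; rewrite eq_le; apply/andP; split.
  by apply: ge_inf => //; exists 0 => M [/ltW].
apply: lb_le_inf => [|M [M_gt0 T_le]]; first by exists (1 / d).
rewrite ler_pdivrMr // -ler_pdivrMl // mulr1 hd.
apply: lb_le_inf => [|_ [w Ww <-]].
  by exists (N [tuple of (x0 - 0) :: b]), 0 => //; exact: hW.1.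
rewrite -[M^-1]mulr1 ler_pdivrMl //.
have := T_le (x0 - w) isT.
by rewrite TE raddfB /= (fW w) // subr0 fx0 divff ?lt0r_neq0 // normr1.
Qed.
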